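(* Let $f\in\mathbb{R}_{\ge0}[z_1,\dots,z_n]$ be a multi-affine polynomial, not identically zero, that is $\Gamma_\alpha$-stable for some $\alpha\in(0,1]$, and let $\mu:2^{[n]}\to\mathbb{R}_{\ge0}$ be the distribution it generates, i.e. $\mu(S)$ is the coefficient of $\prod_{i\in S}z_i$ divided by $f(1,\dots,1)$. Then for every $i\in[n]$, \[\sum_j|\Psi^{\mathrm{inf}}_\mu(i,j)|\le 2/\alpha-1\quad\text{and}\quad\sum_j|\Psi^{\mathrm{cor}}_\mu(i,j)|\le 2/\alpha.\] Consequently $\lambda_{\max}(\Psi^{\mathrm{inf}}_\mu)\le 2/\alpha-1$ and $\lambda_{\max}(\Psi^{\mathrm{cor}}_\mu)\le 2/\alpha$.
   Context: $\Gamma_\alpha=\{\exp(x+iy):x\in\mathbb{R},|y|<\alpha\pi/2\}$; $f$ is $\Gamma_\alpha$-stable if $f(z)\ne0$ whenever all $z_i\in\Gamma_\alpha$. For $T\sim\mu$ write $\mathbb{P}[j]=\mathbb{P}[j\in T]$, $\mathbb{P}[j\mid i]=\mathbb{P}[j\in T\mid i\in T]$, $\mathbb{P}[j\mid\bar i]=\mathbb{P}[j\in T\mid i\notin T]$. The signed pairwise influence matrix is $\Psi^{\mathrm{inf}}_\mu(i,i)=0$ and $\Psi^{\mathrm{inf}}_\mu(i,j)=\mathbb{P}[j\mid i]-\mathbb{P}[j\mid\bar i]$ for $j\ne i$; the correlation matrix is $\Psi^{\mathrm{cor}}_\mu(i,i)=1-\mathbb{P}[i]$ and $\Psi^{\mathrm{cor}}_\mu(i,j)=\mathbb{P}[j\mid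 i]-\mathbb{P}[j]$ for $j\ne i$. An entry is set to $0$ whenever a conditional probability in it is undefined (conditioning event of probability $0$). Both matrices have real eigenvalues. *)

(* Defs.v *)
From HB Require Import structures.
From mathcomp Require Import all_boot all_order all_algebra.
From mathcomp Require Import complex.
From mathcomp Require Import classical_sets reals sequences trigo.
From mathcomp Require Import mpoly.
From mathcomp Require Import ring.

Set Implicit Arguments.
Unset Strict Implicit.
Unset Printing Implicit Defensive.

Import Order.TTheory GRing.Theory Num.Theory.

Local Open Scope ring_scope.

Section Polynomials.
Context {R : realType} {n : nat}.

Definition expC (z : R[i]) : R[i] :=
  ((expR (complex.Re z) * cos (complex.Im z))
  +i* (expR (complex.Re z) * sin (complex.Im z)))%C.

Definition sector (alpha : R) : set R[i] :=
  [set z | exists x y : R, `|y| < alpha * pi / 2 /\ z = expC (x +i* y)%C]%classic.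

Definition sector_stable (alpha : R) (f : {mpoly R[n]}) : Prop :=
  forall z : 'I_n -> R[i], (forall i, sector alpha (z i)) ->
    (map_mpoly (real_complex R) f).@[z] != 0.

Definition multi_affine (f : {mpoly R[n]}) : Prop :=
  forall m, m \in msupp f -> forall i, (m i <= 1)%N.

(* [mesym1 S] is the exponent vector of the monomial \prod_(i in S) 'X_i. *)
Definition generated_distr (f : {mpoly R[n]}) (S : {set 'I_n}) : R :=
  f@_(mesym1 S) / f.@[fun=> 1].

End Polynomials.

Section Matrices.
Context {R : realType} {n : nat}.
Implicit Types (mu : {set 'I_n} -> R) (E F : pred {set 'I_n}).

Definition is_distr mu : Prop :=
  (forall S, 0 <= mu S) /\ \sum_S mu S = 1.

Definition Pr mu E : R := \sum_(S | E S) mu S.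

(* Only meaningful when [Pr mu F != 0]. *)
Definition condPr mu E F : R := Pr mu (predI E F) / Pr mu F.

Definition has_elt (i : 'I_n) : pred {set 'I_n} := fun S => i \in S.

Definition Psi_inf mu : 'M[R]_n :=
  \matrix_(i, j)
    if (j == i) || (Pr mu (has_elt i) == 0)
       || (Pr mu (predC (has_elt i)) == 0) then 0
    else condPr mu (has_elt j) (has_elt i)
         - condPr mu (has_elt j) (predC (has_elt i)).

Definition Psi_cor mu : 'M[R]_n :=
  \matrix_(i, j)
    if j == i then 1 - Pr mu (has_elt i)
    else if Pr mu (has_elt i) == 0 then 0
    else condPr mu (has_elt j) (has_elt i) - Pr mu (has_elt j).

(* The largest eigenvalue of a matrix with real spectrum; see [lambda_maxP],
   [Psi_inf_real] and [Psi_cor_real] below.  For n = 0 this is [sup set0 = 0]. *)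
Definition lambda_max (A : 'M[R]_n) : R :=
  sup [set a | eigenvalue A a]%classic.

Definition real_spectrum (A : 'M[R]_n) : Prop :=
  forall a : R[i], eigenvalue (map_mx (real_complex R) A) a -> a \is Num.real.

End Matrices.

Lemma generated_distrP (R : realType) (n : nat) (f : {mpoly R[n]}) :
  (forall m, 0 <= f@_m) -> multi_affine f -> f != 0 ->
  is_distr (generated_distr f).
Proof.
move=> f0 fma fn0.
have fE : f.@[fun=> 1] = \sum_(S : {set 'I_n}) f@_(mesym1 S).
  rewrite mevalE (eq_bigr (fun m => f@_m)); last first.
    by move=> m _; rewrite big1 ?mulr1 // => i _; rewrite expr1n.
  have inj : injective (@mesym1 n).
    move=> S T /mnmP e; apply/setP => i.
    by have := e i; rewrite !mnmE; case: (i \in S); case: (i \in T).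
  have mE m : m \in msupp f -> exists S, m = mesym1 S.
    move=> /fma h; exists [set i | m i == 1%N].
    apply/mnmP => i; rewrite mnmE inE.
    by case: (m i) (h i) => [|[|]].
  rewrite (bigID (fun S : {set 'I_n} => mesym1 S \in msupp f)) /=.
  rewrite [X in _ + X]big1 ?addr0; last by move=> S /memN_msupp_eq0.
  rewrite -[RHS]big_filter -(big_map (@mesym1 n) xpredT (fun m => f@_m)).
  apply: perm_big; apply: uniq_perm.
  - exact: msupp_uniq.
  - by rewrite map_inj_uniq // filter_uniq // index_enum_uniq.
  move=> m; apply/idP/mapP => [mf|[S]].
    by have [S mS] := mE _ mf; exists S; rewrite // mem_filter -mS mf mem_index_enum.
  by rewrite mem_filter => /andP[+ _] => /[swap] ->.
have fge0 : 0 <= f.@[fun=> 1] by rewrite fE sumr_ge0.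
split; first by move=> S; rewrite divr_ge0.
rewrite /generated_distr -mulr_suml -fE divff //.
rewrite mevalE psumr_neq0; last first.
  by move=> m _; rewrite big1 ?mulr1 // => i _; rewrite expr1n.
have [m mf] : exists m, m \in msupp f.
  case E : (msupp f : seq _) => [|m s]; last by exists m; rewrite inE eqxx.
  by move: E fn0 => /eqP; rewrite msupp_eq0 => ->.
apply/hasP; exists m => //=.
rewrite big1 ?mulr1; last by move=> i _; rewrite expr1n.
by rewrite lt0r f0 -mcoeff_msupp mf.
Qed.

Section Spectrum.
Context {R : realType} {n : nat}.
Implicit Types (mu : {set 'I_n} -> R) (A : 'M[R]_n).

Lemma symmetrizable_real A (d : 'I_n -> R) :
  (forall i, 0 < d i) -> (forall i j, d i * A i j = d j * A j i) ->
  real_spectrum A.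
Proof.
move=> d0 dA a /eigenvalueP[v vA vn0].
(* w i = v i / d i; \sum_ij w i (d i A i j) conj (w j) = a \sum_j d j |w j|^2 *)
pose w i := v 0 i / (d i)%:C%C.
have dn i : (d i)%:C%C != 0 :> R[i] by rewrite (inj_eq (@complexI _)) gt_eqF.
have vE i : v 0 i = w i * (d i)%:C%C by rewrite /w divfK.
pose q := \sum_j \sum_i w i * (d i * A i j)%:C%C * (w j)^*.
have qE : q = a * \sum_j (d j)%:C%C * `|w j| ^+ 2.
  rewrite /q mulr_sumr; apply: eq_bigr => j _.
  have := congr1 (fun u : 'rV_n => u 0 j) vA; rewrite !mxE => e.
  rewrite normCK mulrA mulrA [_ * w j]mulrC.
  have -> : w j * (a * (d j)%:C%C) = a * v 0 j by rewrite vE mulrCA.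
  rewrite -e -mulr_suml; congr (_ * _); apply: eq_bigr => i _.
  by rewrite !mxE vE rmorphM mulrA.
have qr : q \is Num.real.
  pose s i j : R[i] := (d i * A i j)%:C%C.
  have sC i j : (s i j)^* = s i j by apply/CrealP/complex_realP; eexists.
  have sT i j : s i j = s j i by rewrite /s dA.
  rewrite CrealE; apply/eqP; rewrite {2}/q exchange_big rmorph_sum /=.
  apply: eq_bigr => j _; rewrite rmorph_sum; apply: eq_bigr => i _ /=.
  rewrite -/(s i j) -/(s j i) 2!rmorphM /= conjCK sC (sT j i).
  by rewrite mulrC mulrA mulrAC.
have s0 : 0 < \sum_j (d j)%:C%C * `|w j| ^+ 2.
  have t0 j : 0 <= (d j)%:C%C * `|w j| ^+ 2 :> R[i].
    by rewrite mulr_ge0 ?exprn_ge0 // lecR ltW.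
  have [j vj] := rV0Pn _ vn0.
  rewrite (bigD1 j) //= ltr_wpDr ?sumr_ge0 // pmulr_rgt0 ?ltcR //.
  by rewrite exprn_gt0 // normr_gt0 mulf_neq0 // invr_eq0.
by rewrite -(mulfK (lt0r_neq0 s0) a) -qE rpredM // rpredV gtr0_real.
Qed.

Lemma eigenvalue_complex A (a : R) :
  eigenvalue (map_mx (real_complex R) A) a%:C%C = eigenvalue A a.
Proof.
by rewrite !eigenvalue_root_char -map_char_poly fmorph_root.
Qed.

Lemma lambda_maxP A : (0 < n)%N -> real_spectrum A ->
  eigenvalue A (lambda_max A) /\
  (forall a : R[i], eigenvalue (map_mx (real_complex R) A) a ->
     a <= (lambda_max A)%:C%C).
Proof.
move=> n0 rA.
have [l eA maxA] : exists2 l, eigenvalue A l & forall b, eigenvalue A b -> b <= l.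
  have [r rE] : exists r : seq R, forall b, eigenvalue A b = (b \in r).
    have [r rP] := closed_field_poly_normal
      (char_poly (map_mx (real_complex R) A)).
    exists [seq complex.Re x | x <- r] => b.
    rewrite -eigenvalue_complex eigenvalue_root_char rP.
    rewrite (monicP (char_poly_monic _)) scale1r root_prod_XsubC.
    apply/idP/mapP => [br|[x xr ->]]; first by exists b%:C%C.
    rewrite RRe_real //; apply: rA; rewrite eigenvalue_root_char rP.
    by rewrite (monicP (char_poly_monic _)) scale1r root_prod_XsubC.
  have [b bA] : exists b, eigenvalue A b.
    have [|x] := @closed_rootP _ (char_poly (map_mx (real_complex R) A)) _.
      by rewrite size_char_poly; case: (n) n0.
    rewrite -eigenvalue_root_char => xA.
    exists (complex.Re x); rewrite -eigenvalue_complex RRe_real //; exact: rA.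
  have br : b \in r by rewrite -rE.
  exists (\big[Order.max/b]_(x <- r) x).
    rewrite rE big_seq; elim/big_ind: _ => // x y xr yr.
    by case: (leP x y).
  move=> c; rewrite rE => cr; exact: le_bigmax_seq.
have lE : lambda_max A = l.
  apply/le_anti/andP; split; last by apply: ub_le_sup => //; exists l.
  by apply: ge_sup => //; exists l.
split; rewrite lE // => a aA.
have := aA; rewrite -[a]RRe_real ?rA // eigenvalue_complex lecR; exact: maxA.
Qed.

Section Distributions.
Context (mu : {set 'I_n} -> R) (mu_distr : is_distr mu).

Let P i := Pr mu (has_elt i).
Let Q i j := Pr mu (predI (has_elt j) (has_elt i)).

Let P_ge0 i : 0 <= P i.
Proof. by apply: sumr_ge0 => S _; case: mu_distr. Qed.

Let PC i : Pr mu (predC (has_elt i)) = 1 - P i.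
Proof.
case: mu_distr => _ <-; rewrite (bigID (has_elt i)) /= /P /Pr.
by rewrite [X in X - _]addrC addrK.
Qed.

Let PC_ge0 i : 0 <= 1 - P i.
Proof. by rewrite -PC; apply: sumr_ge0 => S _; case: mu_distr. Qed.

Let QC i j : Pr mu (predI (has_elt j) (predC (has_elt i))) = P j - Q i j.
Proof.
rewrite /P /Q /Pr [X in X - _](bigID (has_elt i)) /=.
by rewrite [X in X - _]addrC addrK.
Qed.

Let QT i j : Q i j = Q j i.
Proof. by apply: eq_bigl => S; rewrite /= andbC. Qed.

Let Q0 i j : P i = 0 -> Q i j = 0.
Proof.
move=> Pi0; apply/le_anti; rewrite -{1}Pi0 {1}/P /Q /Pr; apply/andP; split.
  rewrite [leRHS](bigID (has_elt j)) /=.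
  under eq_bigl do rewrite andbC.
  by rewrite lerDl sumr_ge0 // => S _; case: mu_distr.
by apply: sumr_ge0 => S _; case: mu_distr.
Qed.

Let Q1 i j : 1 - P i = 0 -> Q i j = P j.
Proof.
move=> Pi1; apply/eqP; rewrite eq_sym -subr_eq0 -QC; apply/eqP/le_anti.
rewrite -{1}Pi1 -PC /Pr; apply/andP; split.
  rewrite [leRHS](bigID (has_elt j)) /=.
  under eq_bigl do rewrite andbC.
  by rewrite lerDl sumr_ge0 // => S _; case: mu_distr.
by apply: sumr_ge0 => S _; case: mu_distr.
Qed.

Lemma Psi_inf_real : real_spectrum (Psi_inf mu).
Proof.
apply: (@symmetrizable_real _
  (fun i => if P i * (1 - P i) == 0 then 1 else P i * (1 - P i))).
  move=> i; case: eqP => // /eqP h.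
  by rewrite lt0r h mulr_ge0.
have E i j : (if P i * (1 - P i) == 0 then 1 else P i * (1 - P i)) *
    Psi_inf mu i j = if j == i then 0 else Q i j - P i * P j.
  rewrite mxE -/(P i) PC mulf_eq0.
  case: (altP (j =P i)) => [->|_] /=; first by rewrite mulr0.
  case: eqP => /= [P0|/eqP P0]; first by rewrite Q0 // P0 mul0r subrr mulr0.
  case: eqP => /= [P1|/eqP P1].
    by rewrite mulr0 Q1 // -[X in X - _]mul1r -mulrBl P1 mul0r.
  rewrite /condPr -/(P i) -/(Q i j) PC QC.
  move: (P i) (P j) (Q i j) P0 P1 => x y q x0 x1.
  by field; rewrite x0 x1.
move=> i j; rewrite !E eq_sym; case: eqP => // _.
by rewrite QT mulrC.
Qed.

Lemma Psi_cor_real : real_spectrum (Psi_cor mu).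
Proof.
apply: (@symmetrizable_real _ (fun i => if P i == 0 then 1 else P i)).
  by move=> i; case: eqP => // /eqP h; rewrite lt0r h P_ge0.
move=> i j; have [->//|ij] := altP (i =P j).
have E k l : l != k -> (if P k == 0 then 1 else P k) * Psi_cor mu k l
     = Q k l - P k * P l.
  move=> lk; rewrite mxE (negbTE lk) -/(P k) -/(P l).
  case: eqP => [P0|/eqP P0]; first by rewrite Q0 // P0 mul0r subrr mulr0.
  rewrite /condPr -/(P k) -/(Q k l).
  by move: (P k) (P l) (Q k l) P0 => x y q x0; field.
by rewrite !E // 1?eq_sym // QT mulrC.
Qed.

End Distributions.
End Spectrum.

(* Main.v *)
(** Fix [i] and signs [s j], and restrict [f] to [z i = z], [z j = w ^ (s j)].
    Up to a power of [w] this is [z * p w + q w] with [p], [q] univariate, and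
    stability says that [p w / q w] avoids [- Gamma_alpha] when [w] is in
    [Gamma_alpha].  So [u |-> log (p / q) (exp u)] maps the strip
    [|Im u| < alpha pi / 2] into the strip [|Im| < pi - alpha pi / 2] and is real
    on the real axis.  By the maximum principle for its imaginary part on half
    of the strip, its derivative at [0] is at most the ratio [2 / alpha - 1] of
    the widths.  This derivative is the sum of [s j * Psi_inf i j], and the signs
    are free.  Row sums of absolute values bound the eigenvalues, and
    [Psi_cor i j = (1 - P[i]) * ((j == i) + Psi_inf i j)]. *)
Require Import Defs.
From mathcomp Require Import all_boot all_order all_algebra.
From mathcomp Require Import complex.
From mathcomp Require Import classical_sets reals sequences trigo.
From mathcomp Require boolp topology normedtype derive realfun exp mpoly.
From mathcomp Require Import ring lra.

Set Implicit Arguments.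
Unset Strict Implicit.
Unset Printing Implicit Defensive.

Import Order.TTheory GRing.Theory Num.Theory.

Local Open Scope ring_scope.

Section Analysis.
Import boolp topology normedtype derive realfun exp.
Import numFieldNormedType.Exports.

Local Notation Re := complex.Re.
Local Notation Im := complex.Im.

(** * Second-derivative test and harmonic functions on a strip *)

Lemma is_derive_pos_right (R : realType) (g : R -> R) (c k : R) :
  is_derive c 1 g k -> 0 < k -> g c = 0 ->
  exists2 d, 0 < d & forall h, 0 < h < d -> 0 < g (c + h).
Proof.
move=> gk k0 gc0.
have /cvgrPdist_lt /(_ k k0) : (h^-1 *: (g (h *: 1 + c) - g c) @[h --> 0^'] --> k)%classic.
  have := @ex_derive _ _ _ _ _ _ _ gk.
  by rewrite -[k in (_ --> k)%classic](@derive_val _ _ _ _ _ _ _ gk).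
rewrite near_withinE => /nbhs_ballP[d /= d0 dP]; exists d => // h /andP[h0 hd].
have := dP h; rewrite /ball /= sub0r normrN gtr0_norm // gt_eqF // => /(_ hd isT).
rewrite gc0 subr0 [_ *: 1]mulr1 [h + c]addrC => /(le_lt_trans (ler_norm _)).
rewrite ltrBlDr -ltrBlDl subrr => e.
by rewrite -(@pmulr_rgt0 _ h^-1) ?invr_gt0.
Qed.

(** Fermat's rule gives [g c = 0]. If [k > 0], then [g] is positive just to the right of [c], and by
    the mean value theorem [v] exceeds [v c] there. *)
Lemma second_derivative_at_max (R : realType) (v g : R -> R) (a b c k : R) :
  c \in `]a, b[ -> (forall t, t \in `]a, b[ -> is_derive t 1 v (g t)) ->
  is_derive c 1 g k -> (forall t, t \in `]a, b[ -> v t <= v c) -> k <= 0.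
Proof.
move=> cab vg gk vmax; rewrite leNgt; apply/negP => k0.
have ab : a <= b by move: cab; rewrite in_itv /= => /andP[*]; lra.
have gc0 : g c = 0.
  have h := derive1_at_max ab (fun t tab => @ex_derive _ _ _ _ _ _ _ (vg t tab)) cab vmax.
  by rewrite -(@derive_val _ _ _ _ _ _ _ (vg c cab)) (@derive_val _ _ _ _ _ _ _ h).
have [d d0 dP] := is_derive_pos_right gk k0 gc0.
move: cab; rewrite in_itv /= => /andP[ac cb].
pose e := Num.min (d / 2) ((b - c) / 2).
have e0 : 0 < e by rewrite lt_min; apply/andP; split; lra.
have ed : e < d by rewrite /e gt_min; apply/orP; left; lra.
have eb : c + e < b.
  have : e <= (b - c) / 2 by rewrite /e ge_min lexx orbT.
  lra.
have inab t : t \in `[c, c + e] -> t \in `]a, b[.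
  by rewrite !in_itv /= => /andP[*]; apply/andP; split; lra.
have vge x : x \in `]c, c + e[ -> is_derive x 1 v (g x).
  by move=> xc; apply/vg/inab; exact: subset_itv_oo_cc.
have vc : {within `[c, c + e], continuous v}%classic.
  apply: continuous_in_subspaceT => x; rewrite inE /= => xc.
  apply: differentiable_continuous; apply/derivable1_diffP.
  exact: (@ex_derive _ _ _ _ _ _ _ (vg x (inab x xc))).
have ce : c < c + e by rewrite ltrDl.
have [x xc] := MVT ce vge vc.
rewrite addrAC subrr add0r => E.
have : v (c + e) <= v c.
  by apply/vmax/inab; rewrite in_itv /= lexx lerDl ltW.
apply/negP; rewrite -ltNge -subr_gt0 E mulr_gt0 //.
have -> : x = c + (x - c) by ring.
move: xc; rewrite in_itv /= => /andP[*].
by apply: dP; apply/andP; split; lra.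
Qed.

Lemma continuous_on (T : topologicalType) (R : realType) (A : set T) (f : T -> R) :
  (forall x, A x -> {for x, continuous f}) -> {within A, continuous f}%classic.
Proof. by move=> h; apply: continuous_in_subspaceT => x /set_mem; exact: h. Qed.

(* Comparison with the harmonic function [B * y / a]: adding
   [- e * (x ^+ 2 - 2 * y ^+ 2 + 2 * a ^+ 2)] makes the difference strictly
   subharmonic and negative near infinity. *)
Lemma harmonic_strip_bound (R : realType) (th gx gy k : R -> R -> R) (A B a y : R) :
  (forall x y : R, `|y| < A -> is_derive x 1 (th^~ y) (gx x y)) ->
  (forall x y : R, `|y| < A -> is_derive x 1 (gx^~ y) (k x y)) ->
  (forall x y : R, `|y| < A -> is_derive y 1 (th x) (gy x y)) ->
  (forall x y : R, `|y| < A -> is_derive y 1 (gy x) (- k x y)) ->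
  (forall x y : R, `|y| < A -> {for (x, y), continuous (fun u : R * R => th u.1 u.2)}) ->
  (forall x, th x 0 = 0) -> (forall x y : R, `|y| < A -> th x y <= B) ->
  0 < a < A -> 0 <= y <= a -> th 0 y <= B * y / a.
Proof.
move=> thx gxk thy gyk thc th0 thB /andP[a0 aA] /andP[y0 ya].
have B0 : 0 <= B by rewrite -(th0 0) thB // normr0 (lt_trans a0).
apply/ler_addgt0Pr => e' e'0.
pose e := e' / (2 * a ^+ 2).
have e0 : 0 < e by rewrite divr_gt0 // mulr_gt0 // exprn_gt0.
pose v x y := th x y - B * y / a - e * (x ^+ 2 - 2 * y ^+ 2 + 2 * a ^+ 2).
suff v0 : v 0 y <= 0.
  have : e * (2 * a ^+ 2) = e' by rewrite /e divfK // gt_eqF // mulr_gt0 // exprn_gt0.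
  have : 0 <= e * y ^+ 2 by rewrite mulr_ge0 ?sqr_ge0 // ltW.
  by move: v0; rewrite /v; lra.
(* For [|x| >= X] the penalty [e * x ^+ 2] outweighs the bound [B] on [th], so the maximum only has
   to be studied on the compact rectangle [K]. *)
pose X := B / e + 1.
have X1 : 1 <= X by rewrite lerDr divr_ge0 // ltW.
have X2 : B <= e * X ^+ 2.
  have : B = e * (X - 1) by rewrite /X addrK mulrC divfK // gt_eqF.
  by move=> ->; rewrite ler_pM2l //; nra.
have inA t : 0 <= t <= a -> `|t| < A.
  by move=> /andP[t0 ta]; rewrite ger0_norm //; lra.
have rA t : 0 <= t <= a -> 0 <= B * t / a <= B.
  move=> /andP[t0 ta]; rewrite divr_ge0 ?mulr_ge0 ?(ltW a0) //=.
  by rewrite ler_pdivrMr // ler_wpM2l.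
have yA t : 0 <= t <= a -> 0 <= t ^+ 2 <= a ^+ 2.
  by move=> /andP[t0 ta]; rewrite sqr_ge0 ler_sqr ?nnegrE // ltW.
pose K := (`[- X, X] `*` `[0, a])%classic : set (R * R).
have K0 : (K !=set0)%classic.
  by exists (0, 0); split; rewrite /= in_itv /=; apply/andP; split; lra.
have Kc : compact K by apply: compact_setX; exact: segment_compact.
have vc : {within K, continuous (fun u : R * R => v u.1 u.2)}%classic.
  apply: continuous_on => -[x2 y2] [/= _]; rewrite in_itv /= => y2a.
  have c1 : {for (x2, y2), continuous (fun u : R * R => u.1)} by exact: cvg_fst.
  have c2 : {for (x2, y2), continuous (fun u : R * R => u.2)} by exact: cvg_snd.
  apply: cvgB; first apply: cvgB; first exact/thc/inA.
    by apply: cvgM; [apply: cvgM => //; exact: cvg_cst|exact: cvg_cst].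
  apply: cvgM; first exact: cvg_cst.
  apply: cvgD; last exact: cvg_cst.
  apply: cvgB; first exact: (cvgM c1 c1).
  by apply: cvgM; [exact: cvg_cst|exact: (cvgM c2 c2)].
have [[x1 y1] /set_mem [/= xX yX] vmax] := compact_EVT_max K0 Kc vc.
apply: (@le_trans _ _ (v x1 y1)).
  apply: (vmax (0, y)); apply/mem_set; split; rewrite /= in_itv /=;
    apply/andP; split; lra.
move: xX yX; rewrite !in_itv /= => xX yX.
have /andP[rA1 rA2] := rA _ yX.
have /andP[yA1 yA2] := yA _ yX.
have thB1 := thB x1 _ (inA _ yX).
have side : X ^+ 2 <= x1 ^+ 2 -> v x1 y1 <= 0.
  move=> h; rewrite /v.
  have : e * X ^+ 2 <= e * (x1 ^+ 2 - 2 * y1 ^+ 2 + 2 * a ^+ 2).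
    by rewrite ler_pM2l //; lra.
  lra.
have [xr|xr] := leP X x1; first by apply: side; rewrite ler_sqr ?nnegrE; lra.
have [xl|xl] := leP x1 (- X).
  by apply: side; rewrite -[x1 ^+ 2]sqrrN ler_sqr ?nnegrE; lra.
have aa : 0 <= a ^+ 2 by rewrite sqr_ge0.
have xx : 0 <= x1 ^+ 2 by rewrite sqr_ge0.
have [yl|yl] := leP y1 0.
  have -> : y1 = 0 by lra.
  rewrite /v th0 mulr0 mul0r subrr expr0n mulr0 subr0 sub0r oppr_le0.
  by rewrite mulr_ge0 ?(ltW e0) //; lra.
have [yr|yr] := leP a y1.
  have E : y1 = a by lra.
  move: thB1; rewrite /v E mulfK ?gt_eqF // subrK => thB1.
  have : 0 <= e * x1 ^+ 2 by rewrite mulr_ge0 // ltW.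
  lra.
have y1A := inA _ yX.
(* At an interior maximum both pure second derivatives of [v] are nonpositive. Harmonicity cancels
   [k] in their sum, which is [2 * e > 0]. *)
have kx : k x1 y1 - 2 * e <= 0.
  apply: (@second_derivative_at_max R (v^~ y1) (fun x => gx x y1 - e * (2 * x)) (- X) X x1).
  - by rewrite in_itv /= xl.
  - move=> t _; have h := thx t _ y1A; apply: is_derive_eq.
    by rewrite /GRing.scale /=; ring.
  - have h := gxk x1 _ y1A; apply: is_derive_eq.
    by rewrite /GRing.scale /=; ring.
  - move=> t; rewrite in_itv /= => /andP[*]; apply: (vmax (t, y1)).
    by apply/mem_set; split; rewrite //= in_itv /=; apply/andP; split; lra.
have ky : - k x1 y1 + 4 * e <= 0.
  apply: (@second_derivative_at_max R (v x1) (fun y => gy x1 y - B / a + e * (4 * y)) 0 a y1).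
  - by rewrite in_itv /= yl.
  - move=> t; rewrite in_itv /= => /andP[t0 ta].
    have tA : 0 <= t <= a by rewrite !ltW.
    have h := thy x1 _ (inA t tA); apply: is_derive_eq.
    by rewrite /GRing.scale /=; ring.
  - have h := gyk x1 _ y1A; apply: is_derive_eq.
    by rewrite /GRing.scale /=; ring.
  - move=> t; rewrite in_itv /= => /andP[*]; apply: (vmax (x1, t)).
    by apply/mem_set; split; rewrite //= in_itv /=; apply/andP; split; lra.
lra.
Qed.

(** The strip bound with half-width [a] close to [A] keeps [th 0 h / h] close to or below [B / A],
    so a larger slope at [0] is contradicted at a small height [h]. *)
Lemma harmonic_strip_slope (R : realType) (th gx gy k : R -> R -> R) (A B : R) :
  0 < A ->
  (forall x y : R, `|y| < A -> is_derive x 1 (th^~ y) (gx x y)) ->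
  (forall x y : R, `|y| < A -> is_derive x 1 (gx^~ y) (k x y)) ->
  (forall x y : R, `|y| < A -> is_derive y 1 (th x) (gy x y)) ->
  (forall x y : R, `|y| < A -> is_derive y 1 (gy x) (- k x y)) ->
  (forall x y : R, `|y| < A -> {for (x, y), continuous (fun u : R * R => th u.1 u.2)}) ->
  (forall x, th x 0 = 0) -> (forall x y : R, `|y| < A -> th x y <= B) ->
  gy 0 0 <= B / A.
Proof.
move=> A0 thx gxk thy gyk thc th0 thB; rewrite leNgt; apply/negP => sl.
have B0 : 0 <= B by rewrite -(th0 0) thB // normr0.
have h0 : is_derive (0 : R) 1 (fun y => th 0 y - B / A * y) (gy 0 0 - B / A).
  have h := thy 0 0; rewrite normr0 in h; have {}h := h A0.
  by apply: is_derive_eq; rewrite /GRing.scale /=; ring.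
have s0 : 0 < gy 0 0 - B / A by rewrite subr_gt0.
have g0 : th 0 0 - B / A * 0 = 0 by rewrite th0 mulr0 subrr.
have [d d0 dP] := is_derive_pos_right h0 s0 g0.
pose h := Num.min (d / 2) (A / 2).
have hh : 0 < h by rewrite lt_min; apply/andP; split; lra.
have hd : h < d by rewrite /h gt_min; apply/orP; left; lra.
have hA : h < A by rewrite /h gt_min; apply/orP; right; lra.
have := dP h; rewrite hh hd add0r => /(_ isT).
set t := th 0 h; rewrite subr_gt0 mulrAC ltr_pdivrMr // => tA.
have t0 : 0 < t by rewrite -(pmulr_lgt0 _ A0) (le_lt_trans _ tA) // mulr_ge0 // ltW.
(* Any [a] strictly between [B * h / t] and [A] makes the strip bound [B * h / a] smaller than [t];
   the midpoint is taken, and the maximum with [h] ensures [h <= a]. *)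
pose a := Num.max h ((B * h / t + A) / 2).
have BhA : B * h / t < A by rewrite ltr_pdivrMr // [ltRHS]mulrC.
have ha : h <= a by rewrite /a le_max lexx.
have am : (B * h / t + A) / 2 <= a by rewrite /a le_max lexx orbT.
have aA : a < A by rewrite /a gt_max hA /=; lra.
have a0 : 0 < a by apply: lt_le_trans ha.
have := @harmonic_strip_bound R th gx gy k A B a h thx gxk thy gyk thc th0 thB.
rewrite a0 aA (ltW hh) ha -/t => /(_ isT isT).
rewrite ler_pdivlMr // leNgt => /negP; apply.
apply: (@lt_le_trans _ _ (t * ((B * h / t + A) / 2))); last by rewrite ler_pM2l.
have -> : t * ((B * h / t + A) / 2) = (B * h + t * A) / 2.
  by field; rewrite gt_eqF.
lra.
Qed.

(** * Principal argument, and differentiation of complex-valued curves *)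

Section ComplexParts.
Context {R : realType}.
Implicit Types z w : R[i].

Lemma cReD z w : Re (z + w) = Re z + Re w. Proof. by case: z w => ? ? []. Qed.
Lemma cImD z w : Im (z + w) = Im z + Im w. Proof. by case: z w => ? ? []. Qed.
Lemma cReN z : Re (- z) = - Re z. Proof. by case: z. Qed.
Lemma cImN z : Im (- z) = - Im z. Proof. by case: z. Qed.
Lemma cReM z w : Re (z * w) = Re z * Re w - Im z * Im w.
Proof. by case: z w => ? ? []. Qed.
Lemma cImM z w : Im (z * w) = Re z * Im w + Im z * Re w.
Proof. by case: z w => ? ? []. Qed.
Lemma cReV z : Re z^-1 = Re z / (Re z ^+ 2 + Im z ^+ 2).
Proof. by case: z. Qed.
Lemma cImV z : Im z^-1 = - Im z / (Re z ^+ 2 + Im z ^+ 2).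
Proof. by case: z => a b; rewrite /= mulNr. Qed.
Definition ReImE := (cReD, cImD, cReN, cImN, cReM, cImM, cReV, cImV).

Lemma complex_eq z w : Re z = Re w -> Im z = Im w -> z = w.
Proof. by case: z w => ? ? [? ?] /= -> ->. Qed.

Lemma sqr_norm_gt0 z : z != 0 -> 0 < Re z ^+ 2 + Im z ^+ 2.
Proof.
case: z => a b; rewrite eq_complex /= negb_and => ab.
rewrite lt0r paddr_eq0 ?sqr_ge0 // addr_ge0 ?sqr_ge0 // andbT.
by rewrite !sqrf_eq0 negb_and.
Qed.

Lemma expCD z w : expC (z + w) = expC z * expC w.
Proof.
apply: complex_eq; rewrite ReImE /= !ReImE expRD ?cosD ?sinD; ring.
Qed.

Definition cabs z : R := Num.sqrt (Re z ^+ 2 + Im z ^+ 2).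

Lemma sqr_cabs z : cabs z ^+ 2 = Re z ^+ 2 + Im z ^+ 2.
Proof. by rewrite sqr_sqrtr // addr_ge0 ?sqr_ge0. Qed.

Lemma cabs_ge0 z : 0 <= cabs z. Proof. exact: sqrtr_ge0. Qed.

Lemma cabs_gt0 z : z != 0 -> 0 < cabs z.
Proof. by move=> /sqr_norm_gt0 h; rewrite sqrtr_gt0. Qed.

(* The principal argument, by the half-angle formula; it is the junk value
   [0] on the negative real axis. *)
Definition arg z : R := 2 * atan (Im z / (cabs z + Re z)).

(** The plane cut along the closed negative real axis: [cabs z + Re z] is never negative and
    vanishes exactly on that axis. *)
Definition slit z : bool := 0 < cabs z + Re z.

Lemma slitP z : (forall r, 0 <= r -> z != - (r%:C)%C) -> slit z.
Proof.
move=> zn; have z0 : z != 0 by have := zn 0 (lexx _); rewrite oppr0.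
rewrite /slit; have [b0|b0] := eqVneq (Im z) 0.
  have a0 : 0 < Re z.
    rewrite ltNge; apply/negP => a0.
    have := zn (- Re z); rewrite oppr_ge0 => /(_ a0) /eqP; apply.
    by apply: complex_eq; rewrite ?ReImE /= ?opprK ?oppr0.
  by rewrite ltr_wpDl ?cabs_ge0.
have : Re z ^+ 2 < cabs z ^+ 2 by rewrite sqr_cabs ltrDl lt0r sqrf_eq0 b0 sqr_ge0.
rewrite -subr_gt0 subr_sqr => h; rewrite ltNge; apply/negP => h'.
have := cabs_ge0 z; nra.
Qed.

Lemma slit_neq0 z : slit z -> z != 0.
Proof.
apply: contraTneq => ->.
by rewrite /slit /cabs /= !expr0n !addr0 sqrtr0 ltxx.
Qed.

Lemma arg_lt_pi z : `|arg z| < pi.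
Proof.
rewrite /arg ltr_norml; have := atan_ltpi2 (Im z / (cabs z + Re z)).
have := atan_gtNpi2 (Im z / (cabs z + Re z)); lra.
Qed.

Lemma arg_real z : Im z = 0 -> arg z = 0.
Proof. by move=> h; rewrite /arg h mul0r atan0 mulr0. Qed.

(** With [t = arg z / 2], the value of [tan t] determines [cos t ^+ 2] and [cos t * sin t]; the
    double-angle formulas then give [Re z / cabs z] and [Im z / cabs z] as cosine and sine of
    [arg z]. *)
Lemma expC_arg z : slit z -> expC (ln (cabs z) +i* arg z)%C = z.
Proof.
move=> zs; have r0 := cabs_gt0 (slit_neq0 zs).
rewrite /expC /= lnK ?posrE // /arg mulr_natl cos_mulr2n sin_mulr2n.
have sq := sqr_cabs z; move: zs; rewrite /slit => zs.
set r := cabs z in r0 sq zs *; set a := Re z in sq zs *; set b := Im z in sq *.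
set t := atan _.
have tt : tan t = b / (r + a) by rewrite /t atanK.
have ct0 : cos t != 0.
  by apply/lt0r_neq0/cos_gt0_pihalf; rewrite atan_gtNpi2 atan_ltpi2.
have ct : cos t ^+ 2 = (r + a) / (2 * r).
  rewrite -[LHS]invrK cos2_tan2 // tt expr_div_n.
  have -> : b ^+ 2 = (r + a) * (r - a) by rewrite mulrC -subr_sqr sq; ring.
  by field; apply/and3P; split; rewrite gt_eqF //; lra.
have st : cos t * sin t = b / (2 * r).
  have -> : cos t * sin t = tan t * cos t ^+ 2 by rewrite /tan; field.
  rewrite tt ct; field; rewrite !gt_eqF //.
apply: complex_eq; rewrite /= ?ct ?st; field; rewrite gt_eqF //.
Qed.

(** Holomorphic functions are differentiated only along curves with a real parameter, namely
    horizontal and vertical lines; the Cauchy-Riemann equations then become a factor [i] between the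
    two derivatives. *)
Definition cderiv (c : R -> R[i]) (t : R) (d : R[i]) : Prop :=
  is_derive t 1 (fun s => Re (c s)) (Re d) /\ is_derive t 1 (fun s => Im (c s)) (Im d).

Lemma cderiv_eq c t d d' : cderiv c t d -> d = d' -> cderiv c t d'.
Proof. by move=> + <-. Qed.

Lemma cderiv_cst z t : cderiv (fun=> z) t 0.
Proof. by split; exact: is_derive_cst. Qed.

Lemma cderivD c1 c2 t d1 d2 : cderiv c1 t d1 -> cderiv c2 t d2 ->
  cderiv (fun s => c1 s + c2 s) t (d1 + d2).
Proof.
move=> [r1 i1] [r2 i2]; split.
  by rewrite (funext (fun s => cReD (c1 s) (c2 s))) cReD; exact: is_deriveD.
by rewrite (funext (fun s => cImD (c1 s) (c2 s))) cImD; exact: is_deriveD.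
Qed.

Lemma cderivN c t d : cderiv c t d -> cderiv (fun s => - c s) t (- d).
Proof.
move=> [r1 i1]; split.
  by rewrite (funext (fun s => cReN (c s))) cReN; exact: is_deriveN.
by rewrite (funext (fun s => cImN (c s))) cImN; exact: is_deriveN.
Qed.

Lemma cderivM c1 c2 t d1 d2 : cderiv c1 t d1 -> cderiv c2 t d2 ->
  cderiv (fun s => c1 s * c2 s) t (d1 * c2 t + c1 t * d2).
Proof.
move=> [r1 i1] [r2 i2]; split.
  rewrite (funext (fun s => cReM (c1 s) (c2 s))); apply: is_derive_eq.
  by rewrite !ReImE /GRing.scale /=; ring.
rewrite (funext (fun s => cImM (c1 s) (c2 s))); apply: is_derive_eq.
by rewrite !ReImE /GRing.scale /=; ring.
Qed.

Lemma cderivV c t d : c t != 0 -> cderiv c t d ->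
  cderiv (fun s => (c s)^-1) t (- (d / c t / c t)).
Proof.
move=> /sqr_norm_gt0 n0 [r1 i1].
have nn0 : Re (c t) ^+ 2 + Im (c t) ^+ 2 != 0 by rewrite gt_eqF.
have hn : is_derive t 1 (fun s => (Re (c s) ^+ 2 + Im (c s) ^+ 2)^-1)
   (- (2 * (Re (c t) * Re d + Im (c t) * Im d)) / (Re (c t) ^+ 2 + Im (c t) ^+ 2) ^+ 2).
  apply: is_derive_eq.
  by rewrite /GRing.scale /=; field.
split.
  rewrite (funext (fun s => cReV (c s))); apply: is_derive_eq.
  by rewrite !ReImE /GRing.scale /=; field.
rewrite (funext (fun s => cImV (c s))); apply: is_derive_eq.
by rewrite !ReImE /GRing.scale /=; field.
Qed.

Lemma cderiv_horner (p : {poly R[i]}) c t d : cderiv c t d ->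
  cderiv (fun s => p.[c s]) t (p^`().[c t] * d).
Proof.
move=> cd; elim/poly_ind: p => [|p a IH].
  rewrite deriv0 horner0 mul0r; under [fun s => _]funext do rewrite horner0.
  exact: cderiv_cst.
under [fun s => _]funext do rewrite hornerMXaddC.
apply: cderiv_eq; first exact: (cderivD (cderivM IH cd) (cderiv_cst _ _)).
by rewrite derivD derivM derivX derivC !hornerE; ring.
Qed.

(** [arg] is the imaginary part of a branch of the logarithm, and the logarithm of [c] has
    derivative [d / c t]. The proof differentiates the half-angle formula directly. *)
Lemma is_derive_arg c t d : slit (c t) -> cderiv c t d ->
  is_derive t 1 (fun s => arg (c s)) (Im (d / c t)).
Proof.
move=> cs [r1 i1]; have c0 := slit_neq0 cs.
have r0 := cabs_gt0 c0; have n0 := sqr_norm_gt0 c0.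
have sq := sqr_cabs (c t).
have hr : is_derive t 1 (fun s => cabs (c s))
    ((Re (c t) * Re d + Im (c t) * Im d) / cabs (c t)).
  apply: is_derive_eq.
    apply: (@is_derive1_comp _ Num.sqrt (fun s => Re (c s) ^+ 2 + Im (c s) ^+ 2)).
    exact: is_derive1_sqrt.
  by rewrite /GRing.scale /= -/(cabs (c t)); field; rewrite gt_eqF.
have hq : cabs (c t) + Re (c t) != 0 by rewrite gt_eqF.
have hv : is_derive t 1 (fun s => (cabs (c s) + Re (c s))^-1)
   (- ((Re (c t) * Re d + Im (c t) * Im d) / cabs (c t) + Re d)
     / (cabs (c t) + Re (c t)) ^+ 2).
  apply: is_derive_eq.
  by rewrite /GRing.scale /=; field; rewrite hq gt_eqF.
have hw : is_derive t 1 (fun s => Im (c s) / (cabs (c s) + Re (c s)))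
    ((Im d * (cabs (c t) + Re (c t)) - Im (c t) *
       ((Re (c t) * Re d + Im (c t) * Im d) / cabs (c t) + Re d))
     / (cabs (c t) + Re (c t)) ^+ 2).
  apply: is_derive_eq; rewrite /GRing.scale /=; field; rewrite hq gt_eqF //.
have ha := @is_derive1_comp _ atan _ _ _ _ (is_derive1_atan _) hw.
apply: is_derive_eq; rewrite /GRing.scale /= !ReImE -sq.
move: (cabs (c t)) (Re (c t)) (Im (c t)) (Re d) (Im d) r0 hq sq => r a b da db.
move=> r0 ra rab; have rn0 : r != 0 by rewrite gt_eqF.
have -> : 1 + (b / (r + a)) ^+ 2 = 2 * r / (r + a).
  have e : b ^+ 2 = r ^+ 2 - a ^+ 2 by rewrite rab; ring.
  by rewrite expr_div_n e; field.
apply/eqP; rewrite -subr_eq0; apply/eqP.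
(* The two sides differ by a multiple of [r ^+ 2 - (a ^+ 2 + b ^+ 2)], which is zero by [rab]. *)
transitivity (db * (r ^+ 2 - (a ^+ 2 + b ^+ 2)) / (r ^+ 2 * (r + a))).
  by field; rewrite ra rn0.
by rewrite -rab subrr mulr0 mul0r.
Qed.

End ComplexParts.

(** * Continuity of complex-valued maps and of the argument *)

Section ComplexContinuity.
Context {R : realType} {T : topologicalType}.
Implicit Types (c : T -> R[i]) (t : T).

Definition ccont c t : Prop :=
  {for t, continuous (fun s => Re (c s))} /\
  {for t, continuous (fun s => Im (c s))}.

Lemma ccont_cst (z : R[i]) t : ccont (fun=> z) t.
Proof. by split; exact: cvg_cst. Qed.

Lemma ccontD c1 c2 t : ccont c1 t -> ccont c2 t -> ccont (fun s => c1 s + c2 s) t.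
Proof.
move=> [r1 i1] [r2 i2]; split.
  by rewrite (funext (fun s => cReD (c1 s) (c2 s))); exact: (cvgD r1 r2).
by rewrite (funext (fun s => cImD (c1 s) (c2 s))); exact: (cvgD i1 i2).
Qed.

Lemma ccontM c1 c2 t : ccont c1 t -> ccont c2 t -> ccont (fun s => c1 s * c2 s) t.
Proof.
move=> [r1 i1] [r2 i2]; split.
  rewrite (funext (fun s => cReM (c1 s) (c2 s))).
  exact: (cvgB (cvgM r1 r2) (cvgM i1 i2)).
rewrite (funext (fun s => cImM (c1 s) (c2 s))).
exact: (cvgD (cvgM r1 i2) (cvgM i1 r2)).
Qed.

Lemma ccontV c t : c t != 0 -> ccont c t -> ccont (fun s => (c s)^-1) t.
Proof.
move=> /sqr_norm_gt0 n0 [r1 i1].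
have hn : {for t, continuous (fun s => (Re (c s) ^+ 2 + Im (c s) ^+ 2)^-1)}.
  by apply: cvgV; [rewrite gt_eqF|exact: (cvgD (cvgM r1 r1) (cvgM i1 i1))].
split.
  by rewrite (funext (fun s => cReV (c s))); exact: (cvgM r1 hn).
by rewrite (funext (fun s => cImV (c s))); exact: (cvgM (cvgN i1) hn).
Qed.

Lemma ccont_horner (p : {poly R[i]}) c t : ccont c t -> ccont (fun s => p.[c s]) t.
Proof.
move=> cc; elim/poly_ind: p => [|p a IH].
  by under [fun s => _]funext do rewrite horner0; exact: ccont_cst.
under [fun s => _]funext do rewrite hornerMXaddC.
exact: (ccontD (ccontM IH cc) (ccont_cst _ _)).
Qed.

Lemma continuous_cabs c t : ccont c t -> {for t, continuous (fun s => cabs (c s))}.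
Proof.
move=> [r1 i1].
apply: (@continuous_comp _ _ _ (fun s => Re (c s) ^+ 2 + Im (c s) ^+ 2) Num.sqrt).
  exact: (cvgD (cvgM r1 r1) (cvgM i1 i1)).
exact: sqrt_continuous.
Qed.

Lemma continuous_arg c t :
  slit (c t) -> ccont c t -> {for t, continuous (fun s => arg (c s))}.
Proof.
move=> cs cc; have := continuous_cabs cc; case: cc => r1 i1 hr.
apply: cvgM; first exact: cvg_cst.
apply: (@continuous_comp _ _ _ (fun s => Im (c s) / (cabs (c s) + Re (c s))) atan);
  last exact: continuous_atan.
apply: (cvgM i1); apply: cvgV; first by rewrite gt_eqF.
exact: (cvgD hr r1).
Qed.

End ComplexContinuity.

(** * The sector as the exponential image of a strip, and zeros of stable pairs *)

Section Sector.
Context {R : realType}.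
Implicit Types (z w : R[i]) (alpha : R).

Lemma expC_neq0 z : expC z != 0.
Proof.
apply/eqP => e; have : cabs (expC z) = 0 by rewrite e /cabs /= !expr0n addr0 sqrtr0.
apply/eqP; rewrite gt_eqF // /cabs sqrtr_gt0 /= !exprMn -mulrDr cos2Dsin2 mulr1.
by rewrite exprn_gt0 // expR_gt0.
Qed.

Lemma expC0 : expC 0 = 1 :> R[i].
Proof. by rewrite /expC /= expR0 cos0 sin0 mulr1 mulr0. Qed.

Lemma expCN z : expC (- z) = (expC z)^-1.
Proof.
apply: (mulIf (expC_neq0 z)); rewrite -expCD addNr expC0.
by rewrite mulVf ?expC_neq0.
Qed.

Lemma sectorP alpha z :
  sector alpha z <-> exists2 u, `|Im u| < alpha * pi / 2 & z = expC u.
Proof.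
split=> [[x [y [h ->]]]|[[x y] h ->]]; first by exists (x +i* y)%C.
by exists x, y.
Qed.

Lemma sector_neq0 alpha z : sector alpha z -> z != 0.
Proof. by move=> /sectorP[u _ ->]; exact: expC_neq0. Qed.

Lemma sectorV alpha z : sector alpha z -> sector alpha z^-1.
Proof.
move=> /sectorP[u hu ->]; apply/sectorP; exists (- u); last by rewrite expCN.
by rewrite cImN normrN.
Qed.

Lemma sector_pos alpha (r : R) : 0 < alpha -> 0 < r -> sector alpha (r%:C)%C.
Proof.
move=> a0 r0; exists (ln r), 0; split.
  by rewrite normr0 !mulr_gt0 ?pi_gt0 // invr_gt0.
by rewrite /expC /= lnK // cos0 sin0 mulr1 mulr0.
Qed.

Lemma sector_scale alpha (r : R) z : 0 < r -> sector alpha z -> sector alpha ((r%:C)%C * z).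
Proof.
move=> r0 /sectorP[u hu ->]; apply/sectorP; exists ((ln r)%:C%C + u).
  by rewrite cImD /= add0r.
rewrite expCD; congr (_ * _).
by rewrite /expC /= lnK // cos0 sin0 mulr1 mulr0.
Qed.

Lemma near_one_arg (c : R -> R[i]) (delta : R) :
  0 < delta -> ccont c 0 -> c 0 = 1 ->
  \forall s \near (0 : R), slit (c s) /\ `|arg (c s)| < delta.
Proof.
move=> d0 cc c0.
have s0 : slit (c 0) by rewrite c0 /slit ltr_wpDl ?cabs_ge0.
have ca := continuous_arg s0 cc; have cb := continuous_cabs cc.
have cs : {for (0 : R), continuous (fun s => cabs (c s) + Re (c s))}.
  exact: (cvgD cb cc.1).
have n1 : \forall s \near (0 : R), slit (c s) by exact: (cvgr_gt _ cs).
have n2 : \forall s \near (0 : R), `|arg (c 0) - arg (c s)| < delta.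
  by move/cvgrPdist_lt : ca; exact.
rewrite c0 arg_real // in n2.
by near=> s; split; [near: s|rewrite -normrN -sub0r; near: s].
Unshelve. all: end_near. Qed.

Lemma sector_mul_arg alpha u z :
  slit z -> `|arg z| < alpha * pi / 2 - `|Im u| -> sector alpha (expC u * z).
Proof.
move=> zs hz; apply/sectorP; exists (u + (ln (cabs z) +i* arg z)%C).
  by rewrite cImD /= (le_lt_trans (ler_normD _ _)) // addrC -ltrBrDr.
by rewrite expCD expC_arg.
Qed.


(* Near a zero [w0] of [p], [- q / p] takes values with every argument: moving
   away from [w0] in a suitable direction makes it positive up to a factor
   close to [1]. *)
Lemma stable_pair_neq0 alpha (p q : {poly R[i]}) w0 : 0 < alpha ->
  (forall z w, sector alpha z -> sector alpha w -> z * p.[w] + q.[w] != 0) ->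
  p != 0 -> sector alpha w0 -> p.[w0] != 0.
Proof.
move=> alpha0 st p0 sw0; apply/negP => /eqP pw0.
have q0 : q.[w0] != 0.
  have s1 : sector alpha (1%:C%C) by exact: sector_pos.
  by have := st _ w0 s1 sw0; rewrite pw0 mulr0 add0r.
have [m [r + pE]] := multiplicity_XsubC p w0; rewrite p0 /root /= => rw0.
have m0 : (0 < m)%N.
  rewrite lt0n; apply: contraNneq rw0 => m0.
  by rewrite -pw0 pE m0 expr0 mulr1.
(* In this direction the [m]-th power of the increment cancels the phase of [- q.[w0] / r.[w0]]: at
   [w s] the quotient [- q / p] equals [s ^- m * psi s], where [psi] tends to [1]. *)
pose zeta := m.-root (- q.[w0] / r.[w0]).
have zetaE : zeta ^+ m = - q.[w0] / r.[w0] by exact: rootCK.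
have w00 := sector_neq0 sw0.
pose w (s : R) := w0 + (s%:C)%C * zeta.
pose chi s := w s / w0.
pose psi s := q.[w s] / q.[w0] * (r.[w0] / r.[w s]).
have w0E : w 0 = w0 by rewrite /w mul0r addr0.
have wc : ccont w 0.
  apply: ccontD; first exact: ccont_cst.
  apply: ccontM; last exact: ccont_cst.
  by split; [exact: cvg_id|exact: cvg_cst].
have chic : ccont chi 0 by apply: ccontM => //; exact: ccont_cst.
have psic : ccont psi 0.
  apply: ccontM; first by apply: ccontM; [exact: ccont_horner|exact: ccont_cst].
  apply: ccontM; first exact: ccont_cst.
  by apply: ccontV; [rewrite w0E|exact: ccont_horner].
have chi0 : chi 0 = 1 by rewrite /chi w0E divff.
have psi0 : psi 0 = 1 by rewrite /psi w0E !divff // mulr1.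
have [u uA w0u] := (sectorP alpha w0).1 sw0.
have d0 : 0 < alpha * pi / 2 - `|Im u| by rewrite subr_gt0.
have A0 : 0 < alpha * pi / 2 by rewrite !mulr_gt0 ?pi_gt0 // invr_gt0.
have /nbhs_ballP[e /= e0 eP] : \forall s \near (0 : R),
    (slit (chi s) /\ `|arg (chi s)| < alpha * pi / 2 - `|Im u|) /\
    (slit (psi s) /\ `|arg (psi s)| < alpha * pi / 2).
  by near=> s; split; near: s; exact: near_one_arg.
have [] := eP (e / 2).
  by rewrite /ball /= sub0r normrN gtr0_norm; lra.
set s := e / 2; move=> [chis chia] [psis psia].
have s0 : 0 < s by rewrite divr_gt0.
have sn0 : (s%:C)%C != 0 :> R[i] by rewrite (inj_eq (@complexI _)) gt_eqF.
have ws : sector alpha (w s).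
  have -> : w s = expC u * chi s by rewrite -w0u /chi mulrCA divff // mulr1.
  exact: sector_mul_arg.
have psiS : sector alpha (psi s).
  rewrite -[psi s]mul1r -expC0; apply: sector_mul_arg => //.
  by rewrite normr0 subr0.
have rs0 : r.[w s] != 0.
  apply: contraTneq psis => rs0; apply/negP => /slit_neq0.
  by rewrite /psi rs0 invr0 !mulr0 eqxx.
have si0 : 0 < s^-1 by rewrite invr_gt0.
(* The point [z = s ^- m * psi s] lies in the sector and solves [z * p.[w s] + q.[w s] = 0]. *)
have /eqP := st _ _ (sector_scale (exprn_gt0 m si0) psiS) ws; apply.
rewrite pE hornerM horner_exp hornerXsubC /w addrAC subrr add0r -/(w s).
rewrite exprMn zetaE /psi rmorphXn /= fmorphV.
have sm0 : (s%:C)%C ^+ m != 0 :> R[i] by rewrite expf_neq0.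
rewrite exprVn.
move: ((s%:C)%C ^+ m) (q.[w s]) (q.[w0]) (r.[w0]) (r.[w s]) sm0 q0 rw0 rs0.
move=> x a b c d x0 b0 c0 d0'; by field; rewrite x0 b0 c0 d0'.
Unshelve. all: end_near. Qed.

End Sector.

(** * Logarithmic derivatives along the strip, and the argument of a stable quotient *)

Section LogarithmicDerivative.
Context {R : realType}.
Implicit Types (p q : {poly R[i]}) (c : R -> R[i]).

(** [eulerlog] and [eulerlog2] are the first and second derivatives of [log p] with respect to
    [u = log z], that is, [z d/dz] applied once and twice. *)
Definition eulerlog p (z : R[i]) : R[i] := z * p^`().[z] / p.[z].

Definition eulerlog2 p (z : R[i]) : R[i] :=
  z * (p^`().[z] + z * p^`()^`().[z]) / p.[z] - eulerlog p z ^+ 2.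

(** The hypothesis on [c] says that [log c] moves with velocity [iota]; the values used are [1] on
    horizontal and [i] on vertical lines of the strip. *)
Lemma cderiv_eulerlog p c t (iota : R[i]) : p.[c t] != 0 ->
  cderiv c t (iota * c t) ->
  cderiv (fun s => eulerlog p (c s)) t (iota * eulerlog2 p (c t)).
Proof.
move=> pc0 cd; apply: cderiv_eq.
  apply: cderivM; first by apply: cderivM; [exact: cd|exact: (cderiv_horner _ cd)].
  by apply: cderivV; [|exact: (cderiv_horner _ cd)].
by rewrite /eulerlog2 /eulerlog; field.
Qed.

Lemma is_derive_arg_quotient p q c t (iota : R[i]) :
  p.[c t] != 0 -> q.[c t] != 0 -> slit (p.[c t] / q.[c t]) ->
  cderiv c t (iota * c t) ->
  is_derive t 1 (fun s => arg (p.[c s] / q.[c s]))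
    (Im (iota * (eulerlog p (c t) - eulerlog q (c t)))).
Proof.
move=> pc0 qc0 sl cd.
have cq : cderiv (fun s => p.[c s] / q.[c s]) t
    (p.[c t] / q.[c t] * (iota * (eulerlog p (c t) - eulerlog q (c t)))).
  apply: cderiv_eq.
    apply: cderivM; first exact: (cderiv_horner _ cd).
    by apply: cderivV; [|exact: (cderiv_horner _ cd)].
  by rewrite /eulerlog; field; rewrite pc0 qc0.
have := is_derive_arg sl cq; congr (is_derive _ _ _ (Im _)).
by rewrite mulrC mulKf // mulf_neq0 // invr_neq0.
Qed.

Lemma cderiv_expC_Re (x y : R) :
  cderiv (fun s => expC (s +i* y)%C) x (1 * expC (x +i* y)%C).
Proof.
by split; rewrite mul1r /expC /=; apply: is_derive_eq; rewrite /GRing.scale /=; ring.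
Qed.

Lemma cderiv_expC_Im (x y : R) :
  cderiv (fun s => expC (x +i* s)%C) y ((0 +i* 1)%C * expC (x +i* y)%C).
Proof.
by split; rewrite !ReImE /expC /=; apply: is_derive_eq; rewrite /GRing.scale /=; ring.
Qed.

Lemma ccont_expC (u : R * R) : ccont (fun v : R * R => expC (v.1 +i* v.2)%C) u.
Proof.
have c1 : {for u, continuous (fun v : R * R => expR v.1)}.
  by apply: (@continuous_comp _ _ _ fst expR); [exact: cvg_fst|exact: continuous_expR].
split; apply: (cvgM c1).
  by apply: (@continuous_comp _ _ _ snd cos); [exact: cvg_snd|exact: continuous_cos].
by apply: (@continuous_comp _ _ _ snd sin); [exact: cvg_snd|exact: continuous_sin].
Qed.

(** The sector is closed under inversion, so dividing by [z] exchanges [p] and [q]. *)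
Lemma stable_pairC alpha p q :
  (forall z w, sector alpha z -> sector alpha w -> z * p.[w] + q.[w] != 0) ->
  forall z w, sector alpha z -> sector alpha w -> z * q.[w] + p.[w] != 0.
Proof.
move=> st z w sz sw; have z0 := sector_neq0 sz.
have := st _ _ (sectorV sz) sw; apply: contra_neq => e.
by rewrite -[RHS](mulr0 z^-1) -e mulrDr mulKf // addrC.
Qed.

Lemma stable_pair_quotient alpha p q w :
  (forall z w, sector alpha z -> sector alpha w -> z * p.[w] + q.[w] != 0) ->
  p.[w] != 0 -> q.[w] != 0 -> sector alpha w -> ~ sector alpha (- (p.[w] / q.[w])).
Proof.
move=> st p0 q0 sw sn.
have /eqP := st _ _ (sectorV sn) sw; apply; by field; rewrite p0 q0.
Qed.

Lemma slit_stable_pair alpha p q w : 0 < alpha ->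
  (forall z w, sector alpha z -> sector alpha w -> z * p.[w] + q.[w] != 0) ->
  p.[w] != 0 -> q.[w] != 0 -> sector alpha w -> slit (p.[w] / q.[w]).
Proof.
move=> alpha0 st p0 q0 sw; apply: slitP => r; rewrite le_eqVlt => /predU1P[<-|r0].
  by rewrite oppr0 mulf_neq0 // invr_neq0.
apply/eqP => e; apply: (stable_pair_quotient st p0 q0 sw).
by rewrite e opprK; exact: sector_pos.
Qed.

(** If the argument were larger, subtracting [pi] would give an argument of [- (p / q)] between
    [- alpha * pi / 2] and [0], placing that number in the sector. *)
Lemma arg_stable_pair alpha p q w : 0 < alpha <= 1 ->
  (forall z w, sector alpha z -> sector alpha w -> z * p.[w] + q.[w] != 0) ->
  p.[w] != 0 -> q.[w] != 0 -> sector alpha w ->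
  arg (p.[w] / q.[w]) <= pi - alpha * pi / 2.
Proof.
move=> /andP[alpha0 alpha1] st p0 q0 sw; rewrite leNgt; apply/negP => h.
apply: (stable_pair_quotient st p0 q0 sw).
have sl := slit_stable_pair alpha0 st p0 q0 sw.
move: (p.[w] / q.[w]) h sl => z h sl.
have := arg_lt_pi z; rewrite ltr_norml => /andP[_ zpi].
apply/sectorP; exists (ln (cabs z) +i* (arg z - pi))%C.
  by rewrite /= ltr_norml; apply/andP; split; have := pi_gt0 R; nra.
rewrite -{1}(expC_arg sl) /expC /= cosB sinB cospi sinpi.
by apply: complex_eq; rewrite !ReImE /=; ring.
Qed.

End LogarithmicDerivative.

Lemma log_derivative_bound (R : realType) (alpha : R) (p q : {poly R}) :
  let pC := map_poly (real_complex R) p in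
  let qC := map_poly (real_complex R) q in
  0 < alpha <= 1 ->
  (forall z w, sector alpha z -> sector alpha w -> z * pC.[w] + qC.[w] != 0) ->
  p != 0 -> q != 0 ->
  p^`().[1] / p.[1] - q^`().[1] / q.[1] <= 2 / alpha - 1.
Proof.
move=> pC qC alpha01 st p0 q0; have /andP[alpha0 alpha1] := alpha01.
have pC0 : pC != 0 by rewrite map_poly_eq0.
have qC0 : qC != 0 by rewrite map_poly_eq0.
pose W (x y : R) := expC (x +i* y)%C.
have WS x y : `|y| < alpha * pi / 2 -> sector alpha (W x y) by exists x, y.
have pW x y (h : `|y| < alpha * pi / 2) : pC.[W x y] != 0.
  exact: (stable_pair_neq0 alpha0 st pC0 (WS x y h)).
have qW x y (h : `|y| < alpha * pi / 2) : qC.[W x y] != 0.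
  exact: (stable_pair_neq0 alpha0 (stable_pairC st) qC0 (WS x y h)).
have sl x y (h : `|y| < alpha * pi / 2) : slit (pC.[W x y] / qC.[W x y]).
  exact: (slit_stable_pair alpha0 st (pW x y h) (qW x y h) (WS x y h)).
(* [L] and [M] are the first and second derivatives of [log (p / q)] in [u = x + i y]. *)
pose L x y := eulerlog pC (W x y) - eulerlog qC (W x y).
pose M x y := eulerlog2 pC (W x y) - eulerlog2 qC (W x y).
have Lx x y : `|y| < alpha * pi / 2 -> cderiv (L^~ y) x (M x y).
  move=> h; have e := cderiv_expC_Re x y.
  have ep := @cderiv_eulerlog _ _ (W^~ y) _ _ (pW x y h) e.
  have eq := @cderiv_eulerlog _ _ (W^~ y) _ _ (qW x y h) e.
  by apply: cderiv_eq (cderivD ep (cderivN eq)) _; rewrite !mul1r.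
have Ly x y : `|y| < alpha * pi / 2 -> cderiv (L x) y ((0 +i* 1)%C * M x y).
  move=> h; have e := cderiv_expC_Im x y.
  have ep := @cderiv_eulerlog _ _ (W x) _ _ (pW x y h) e.
  have eq := @cderiv_eulerlog _ _ (W x) _ _ (qW x y h) e.
  exact: cderiv_eq (cderivD ep (cderivN eq)) (esym (mulrBr _ _ _)).
have A0 : 0 < alpha * pi / 2 by rewrite !mulr_gt0 ?pi_gt0 // invr_gt0.
(* The argument has [x]-derivative [Im L] and [y]-derivative [Im (i L) = Re L]. Differentiating once
   more gives [Im M] and [Re (i M) = - Im M], hence harmonicity. *)
have := @harmonic_strip_slope R (fun x y => arg (pC.[W x y] / qC.[W x y]))
  (fun x y => Im (L x y)) (fun x y => Re (L x y)) (fun x y => Im (M x y))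
  (alpha * pi / 2) (pi - alpha * pi / 2) A0.
have W0 : W 0 0 = (1%:C)%C by rewrite /W expC0.
have -> : Re (L 0 0) = p^`().[1] / p.[1] - q^`().[1] / q.[1].
  rewrite /L W0 /eulerlog /pC /qC !deriv_map !horner_map.
  by rewrite -!rmorphM -!fmorph_div -rmorphB /= !mul1r.
have -> : (pi - alpha * pi / 2) / (alpha * pi / 2) = 2 / alpha - 1.
  by have := pi_gt0 R; move: pi => c c0; field; rewrite !gt_eqF.
apply.
- move=> x y h; rewrite -[L x y]mul1r.
  exact: (@is_derive_arg_quotient _ _ _ (W^~ y) _ _ (pW x y h) (qW x y h) (sl x y h)
    (cderiv_expC_Re x y)).
- by move=> x y h; exact: (Lx x y h).2.
- move=> x y h.
  have -> : Re (L x y) = Im ((0 +i* 1)%C * L x y).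
    by rewrite cImM /= mul0r mul1r add0r.
  exact: (@is_derive_arg_quotient _ _ _ (W x) _ _ (pW x y h) (qW x y h) (sl x y h)
    (cderiv_expC_Im x y)).
- move=> x y h; have := (Ly x y h).1.
  by rewrite cReM /= mul0r mul1r sub0r.
- move=> x y h; apply: continuous_arg; first exact: sl.
  have e := ccont_expC (x, y).
  apply: ccontM; first exact: (ccont_horner _ e).
  by apply: ccontV; [exact: qW|exact: (ccont_horner _ e)].
- move=> x; apply: arg_real.
  have -> : W x 0 = ((expR x)%:C)%C by rewrite /W /expC /= cos0 sin0 mulr1 mulr0.
  by rewrite /pC /qC !horner_map -fmorph_div.
- by move=> x y h; apply: arg_stable_pair alpha01 st (pW x y h) (qW x y h) (WS x y h).
Qed.

End Analysis.

Import mpoly.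

(** * Expansion and evaluation of multi-affine polynomials *)

Lemma multi_affineE (R : realType) (n : nat) (f : {mpoly R[n]}) :
  multi_affine f -> f = \sum_(S : {set 'I_n}) f@_(mesym1 S) *: 'X_[mesym1 S].
Proof.
move=> fma; apply/mpolyP => m; rewrite raddf_sum /=.
under eq_bigr do rewrite mcoeffZ mcoeffX.
have [mf|mf] := boolP (m \in msupp f); last first.
  rewrite memN_msupp_eq0 // big1 // => S _.
  by case: eqP => [->|]; rewrite ?mulr0 // memN_msupp_eq0 // mul0r.
have -> : m = mesym1 [set i | m i == 1%N].
  by apply/mnmP => i; rewrite mnmE inE; case: (m i) (fma m mf i) => [|[|]].
rewrite (bigD1 [set i | m i == 1%N]) //= eqxx mulr1 big1 ?addr0 // => S Sn.
by rewrite (inj_eq (@inj_mesym1 n)) (negbTE Sn) mulr0.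
Qed.

Lemma meval_multi_affine (R : realType) (n : nat) (f : {mpoly R[n]})
    (v : 'I_n -> R[i]) : multi_affine f ->
  (map_mpoly (real_complex R) f).@[v] =
    \sum_(S : {set 'I_n}) (f@_(mesym1 S))%:C%C * \prod_(i in S) v i.
Proof.
move=> /multi_affineE {1}->.
rewrite (raddf_sum (map_mpoly (real_complex R))) (raddf_sum (meval v)).
apply: eq_bigr => S _.
transitivity (((f@_(mesym1 S))%:C%C *: 'X_[R[i], mesym1 S]).@[v]).
  congr (meval v _); rewrite -(map_mpolyX (real_complex R)); exact: map_mpolyZ.
rewrite mevalZ mevalX; congr (_ * _).
rewrite [RHS]big_mkcond; apply: eq_bigr => i _; rewrite mnmE.
by case: (i \in S); rewrite ?expr1 ?expr0.
Qed.

(** * Univariate restrictions of the generating polynomial, and row sums *)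

Section Distribution.
Context {R : realType} {n : nat} (mu : {set 'I_n} -> R) (mu_distr : is_distr mu).
Implicit Types (E F : pred {set 'I_n}) (i j : 'I_n) (A : {set 'I_n}).

Lemma Pr_ge0 E : 0 <= Pr mu E.
Proof. by apply: sumr_ge0 => S _; case: mu_distr. Qed.

Lemma PrID E F : Pr mu E = Pr mu (predI F E) + Pr mu (predI (predC F) E).
Proof.
rewrite /Pr (bigID F); congr (_ + _); apply: eq_bigl => S; exact: andbC.
Qed.

Lemma PrC E : Pr mu (predC E) = 1 - Pr mu E.
Proof.
by case: mu_distr => _ <-; rewrite (bigID E) /= /Pr addrAC subrr add0r.
Qed.

Lemma PrI_eq0 E F : Pr mu F = 0 -> Pr mu (predI E F) = 0.
Proof.
move=> F0; apply/le_anti; rewrite Pr_ge0 andbT -F0 (PrID F E) lerDl.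
exact: Pr_ge0.
Qed.

(** The set [A] encodes the signs: [z j] becomes [w] for [j] in [A] and [w^-1] otherwise. After
    multiplication by one [w] for each [j != i] outside [A], this count is the exponent of [w] in
    the monomial of [S]. *)
Definition agreement i A (S : {set 'I_n}) : nat :=
  #|[pred j | (j != i) && ((j \in S) == (j \in A))]|.

Definition agreement_poly i A E : {poly R} :=
  \sum_(S | E S) mu S *: 'X^(agreement i A S).

Lemma horner1_agreement_poly i A E : (agreement_poly i A E).[1] = Pr mu E.
Proof.
rewrite /agreement_poly horner_sum; apply: eq_bigr => S _.
by rewrite hornerZ hornerXn expr1n mulr1.
Qed.

(** The left side is the mean of the agreement count given [E]; linearity of expectation splits it
    into the conditional probabilities that [S] and [A] agree at [j]. *)
Lemma deriv_agreement_poly i A E : Pr mu E != 0 ->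
  (agreement_poly i A E)^`().[1] / (agreement_poly i A E).[1] =
  \sum_(j | j != i) (if j \in A then condPr mu (has_elt j) E
                     else 1 - condPr mu (has_elt j) E).
Proof.
move=> E0; rewrite horner1_agreement_poly; apply: (canLR (mulfK E0)).
have -> : (agreement_poly i A E)^`() =
    \sum_(S | E S) (mu S *: 'X^(agreement i A S))^`().
  exact: raddf_sum.
rewrite horner_sum.
transitivity (\sum_(S | E S) \sum_(j | j != i)
    (if (j \in S) == (j \in A) then mu S else 0)).
  apply: eq_bigr => S _.
  rewrite derivZ derivXn hornerZ hornerMn hornerXn expr1n mulr_natr.
  by rewrite -big_mkcondr /= sumr_const.
rewrite exchange_big mulr_suml; apply: eq_bigr => j _.
have -> : (if j \in A then condPr mu (has_elt j) E else 1 - condPr mu (has_elt j) E)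
    * Pr mu E = if j \in A then Pr mu (predI (has_elt j) E)
                else Pr mu (predI (predC (has_elt j)) E).
  case: ifP => _; first by rewrite /condPr divfK.
  by rewrite mulrBl mul1r /condPr divfK // {1}(PrID E (has_elt j)) addrAC subrr add0r.
rewrite -big_mkcondr /Pr /=; case: (j \in A); apply: eq_bigl => S.
  by rewrite eqb_id andbC.
by rewrite eqbF_neg andbC.
Qed.

Lemma prod_agreement (i : 'I_n) A (S : {set 'I_n}) (z w : R[i]) : w != 0 ->
  w ^+ #|[pred j | (j != i) && (j \notin A)]| *
    \prod_(j in S) (if j == i then z else if j \in A then w else w^-1) =
  (if i \in S then z else 1) * w ^+ agreement i A S.
Proof.
move=> w0; rewrite /agreement -!prodr_const.
rewrite (big_mkcond (mem S)) (big_mkcond (mem [pred j | _ && (j \notin A)])) /=.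
rewrite (big_mkcond (mem [pred j | _ && (_ == _)])) /= -big_split /=.
rewrite (bigD1 i) //= [in RHS](bigD1 i) //= inE eqxx /= mul1r inE eqxx /= mul1r.
congr (_ * _); apply: eq_bigr => j ji; rewrite !inE ji /= (negbTE ji).
by case: (j \in A); case: (j \in S); rewrite /= ?mul1r ?mulr1 ?mulfV.
Qed.

Context (alpha : R) (alpha01 : 0 < alpha <= 1).
Context (mu_stable : forall v : 'I_n -> R[i], (forall i, sector alpha (v i)) ->
  \sum_(S : {set 'I_n}) (mu S)%:C%C * \prod_(i in S) v i != 0).

(** Closure under inversion keeps the substituted point in the sector, and clearing the negative
    exponents costs only a nonzero power of [w]. *)
Lemma agreement_stable i A (z w : R[i]) : sector alpha z -> sector alpha w ->
  z * (map_poly (real_complex R) (agreement_poly i A (has_elt i))).[w] +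
  (map_poly (real_complex R) (agreement_poly i A (predC (has_elt i)))).[w] != 0.
Proof.
move=> sz sw; have w0 := sector_neq0 sw.
pose v j := if j == i then z else if j \in A then w else w^-1.
have sv j : sector alpha (v j).
  by rewrite /v; case: ifP => // _; case: ifP => // _; exact: sectorV.
suff -> : z * (map_poly (real_complex R) (agreement_poly i A (has_elt i))).[w] +
    (map_poly (real_complex R) (agreement_poly i A (predC (has_elt i)))).[w] =
    w ^+ #|[pred j | (j != i) && (j \notin A)]| *
      \sum_(S : {set 'I_n}) (mu S)%:C%C * \prod_(j in S) v j.
  by rewrite mulf_neq0 ?mu_stable // expf_neq0.
have E (P : pred {set 'I_n}) : (map_poly (real_complex R) (agreement_poly i A P)).[w] =
    \sum_(S | P S) (mu S)%:C%C * w ^+ agreement i A S.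
  rewrite /agreement_poly rmorph_sum horner_sum /=; apply: eq_bigr => S _.
  by rewrite map_polyZ map_polyXn hornerZ hornerXn.
rewrite !E [in RHS](bigID (has_elt i)) mulrDr !mulr_sumr /=; congr (_ + _).
  apply: eq_bigr => S iS; rewrite [RHS]mulrCA prod_agreement //.
  by rewrite [i \in S]iS mulrCA.
apply: eq_bigr => S iS; rewrite [RHS]mulrCA prod_agreement //.
by move: iS; rewrite /has_elt => /negbTE ->; rewrite mul1r.
Qed.

Lemma ratio_ge1 : 1 <= 2 / alpha - 1.
Proof.
by have /andP[a0 a1] := alpha01; rewrite lerBrDr ler_pdivlMr //; lra.
Qed.

Lemma Psi_inf_row_sum i : \sum_j `|Psi_inf mu i j| <= 2 / alpha - 1.
Proof.
(* If [i] is almost surely present or almost surely absent, the row is zero by convention, and the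
   bound is nonnegative since [alpha <= 1]. *)
have [P0|/norP[Pi Pci]] :=
    boolP ((Pr mu (has_elt i) == 0) || (Pr mu (predC (has_elt i)) == 0)).
  rewrite big1 ?(le_trans ler01) ?ratio_ge1 // => j _.
  by rewrite mxE -orbA P0 orbT normr0.
(* For [j] outside [A] the agreement probabilities are complements, so their difference changes
   sign; with this [A] each term equals the absolute value of the entry. *)
pose A := [set j | 0 <= Psi_inf mu i j].
have neq0 E : Pr mu E != 0 -> agreement_poly i A E != 0.
  by apply: contra_neq => e; rewrite -(horner1_agreement_poly i A E) e horner0.
have := log_derivative_bound alpha01 (@agreement_stable i A) (neq0 _ Pi) (neq0 _ Pci).
rewrite !deriv_agreement_poly // -sumrB; apply: le_trans.
rewrite (bigD1 i) //= {1}/Psi_inf mxE eqxx /= normr0 add0r le_eqVlt; apply/orP; left.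
apply/eqP/eq_bigr => j ji.
have E : Psi_inf mu i j = condPr mu (has_elt j) (has_elt i)
    - condPr mu (has_elt j) (predC (has_elt i)).
  by rewrite mxE (negbTE ji) (negbTE Pi) (negbTE Pci).
rewrite inE; case: ifPn => [h|]; first by rewrite ger0_norm.
by rewrite -ltNge => /ltr0_norm ->; rewrite E; ring.
Qed.

(** By total probability [P[j]] is the average of [P[j | i]] and [P[j | not i]] with weights [P[i]]
    and [1 - P[i]]; subtract it from [P[j | i]]. *)
Lemma Psi_corE i j :
  Psi_cor mu i j = (1 - Pr mu (has_elt i)) * ((j == i)%:R + Psi_inf mu i j).
Proof.
rewrite !mxE; case: (altP (j =P i)) => [_|_] /=; first by rewrite addr0 mulr1.
rewrite add0r; case: eqP => /= [_|/eqP P0]; first by rewrite mulr0.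
have QE := PrID (has_elt j) (has_elt i).
rewrite /condPr.
have -> : Pr mu (predI (has_elt j) (has_elt i)) = Pr mu (predI (has_elt i) (has_elt j)).
  by apply: eq_bigl => S; exact: andbC.
have -> : Pr mu (predI (has_elt j) (predC (has_elt i))) =
    Pr mu (predI (predC (has_elt i)) (has_elt j)).
  by apply: eq_bigl => S; exact: andbC.
rewrite QE PrC; case: eqP => [P1|/eqP P1].
  (* When [P[i] = 1] the influence entry is [0] by convention, and conditioning on [i] leaves [P[j]]
     unchanged. *)
  rewrite mulr0 (_ : Pr mu (predI (predC (has_elt i)) (has_elt j)) = 0).
    by rewrite (_ : Pr mu (has_elt i) = 1) ?divr1 ?addr0 ?subrr //; lra.
  rewrite -[RHS](@PrI_eq0 (has_elt j) (predC (has_elt i))) ?PrC //.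
  by apply: eq_bigl => S; exact: andbC.
by field; rewrite P1 P0.
Qed.

(** The factor [1 - P[i]] is at most [1], and the diagonal contributes the extra [1] on top of the
    influence bound. *)
Lemma Psi_cor_row_sum i : \sum_j `|Psi_cor mu i j| <= 2 / alpha.
Proof.
have P0 := Pr_ge0 (has_elt i).
have P1 := Pr_ge0 (predC (has_elt i)); rewrite PrC in P1.
have infi := Psi_inf_row_sum i.
apply: (@le_trans _ _ ((1 - Pr mu (has_elt i)) * (1 + \sum_j `|Psi_inf mu i j|))).
  rewrite (_ : 1 + _ = \sum_j ((j == i)%:R + `|Psi_inf mu i j|)).
    rewrite mulr_sumr; apply: ler_sum => j _; rewrite Psi_corE normrM.
    rewrite (ger0_norm P1) ler_wpM2l // (le_trans (ler_normD _ _)) //.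
    by rewrite lerD2r ger0_norm.
  by rewrite big_split; congr (_ + _); rewrite (bigD1 i) //= eqxx big1 ?addr0 // => j /negbTE ->.
apply: (@le_trans _ _ (1 + \sum_j `|Psi_inf mu i j|)); last by rewrite addrC -lerBrDr.
by rewrite ler_piMl ?addr_ge0 ?sumr_ge0 //; lra.
Qed.

End Distribution.

(* A row eigenvector [v] satisfies [|a| |v|_1 <= C |v|_1]. *)
Lemma lambda_max_le (R : realType) (n : nat) (A : 'M[R]_n) (C : R) : 0 <= C ->
  (forall i, \sum_j `|A i j| <= C) -> lambda_max A <= C.
Proof.
move=> C0 AC; rewrite /lambda_max.
have le a : eigenvalue A a -> a <= C.
  move=> /eigenvalueP[v vA v0].
  have s0 : 0 < \sum_j `|v 0 j|.
    have [j vj] := rV0Pn _ v0.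
    by rewrite (bigD1 j) //= ltr_pwDl ?normr_gt0 // sumr_ge0.
  apply: (le_trans (ler_norm a)); rewrite -(ler_pM2r s0) mulr_sumr.
  apply: (@le_trans _ _ (\sum_j \sum_i `|v 0 i| * `|A i j|)).
    apply: ler_sum => j _; have := congr1 (fun u : 'rV_n => u 0 j) vA.
    rewrite !mxE -normrM => <-; apply: le_trans (ler_norm_sum _ _ _) _.
    by apply: ler_sum => i _; rewrite normrM.
  rewrite exchange_big mulr_sumr; apply: ler_sum => i _ /=.
  by rewrite -mulr_sumr mulrC ler_wpM2r.
(* Without eigenvalues, as for [n = 0], [sup] takes its default value [0], and [C0] applies. *)
have [->|/set0P[a aA]] := eqVneq [set a | eigenvalue A a]%classic set0.
  by rewrite sup0.
by apply: ge_sup; [exists a|move=> b /le].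
Qed.

Theorem theorem4p2 (R : realType) (n : nat) (f : {mpoly R[n]}) (alpha : R)
    (f_ge0 : forall m : 'X_{1..n}, 0 <= f@_m)
    (f_multi_affine : multi_affine f)
    (f_neq0 : f != 0)
    (alpha_gt0 : 0 < alpha) (alpha_le1 : alpha <= 1)
    (f_stable : sector_stable alpha f) :
  let mu := generated_distr f in
  [/\ forall i : 'I_n,
        \sum_(j < n) `|Psi_inf mu i j| <= 2 / alpha - 1 /\
        \sum_(j < n) `|Psi_cor mu i j| <= 2 / alpha,
      lambda_max (Psi_inf mu) <= 2 / alpha - 1
    & lambda_max (Psi_cor mu) <= 2 / alpha].
Proof.
move=> mu; have mu_distr : is_distr mu := generated_distrP f_ge0 f_multi_affine f_neq0.
have alpha01 : 0 < alpha <= 1 by rewrite alpha_gt0.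
have mu_stable (v : 'I_n -> R[i]) : (forall i, sector alpha (v i)) ->
    \sum_(S : {set 'I_n}) (mu S)%:C%C * \prod_(i in S) v i != 0.
  (* The normalization only divides by [f(1,...,1)], so a zero of the generating sum of [mu] is a
     zero of [f]. *)
  move=> /f_stable; rewrite meval_multi_affine //; apply: contra_neq => e.
  transitivity ((f.@[fun=> 1])%:C%C *
      \sum_(S : {set 'I_n}) (mu S)%:C%C * \prod_(i in S) v i); last by rewrite e mulr0.
  rewrite mulr_sumr; apply: eq_bigr => S _; rewrite mulrA -rmorphM /=.
  congr (_%:C%C * _); rewrite /mu /generated_distr mulrC divfK //.
  (* If [f(1,...,1)] were [0], division by zero would make [mu] vanish, against its total mass
     [1]. *)
  apply: contraTneq (oner_neq0 R) => f1; rewrite negbK eq_sym.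
  have [_ <-] := mu_distr; rewrite big1 // => T _.
  by rewrite /mu /generated_distr f1 invr0 mulr0.
have r1 := ratio_ge1 alpha01.
have inf i := Psi_inf_row_sum alpha01 mu_stable i.
have cor i := Psi_cor_row_sum mu_distr alpha01 mu_stable i.
split; first by [].
  by apply: lambda_max_le => //; lra.
by apply: lambda_max_le => //; lra.
Qed.
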